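(* Let $\mathcal{B}$ be a triangular graded $S$-bocs and let $f=(f^0,f^1):M\to N$ be a morphism in $\mathrm{G}\mathbb{M}\mathrm{od}^0\text{-}\mathcal{B}$. Then $f:M\to N$ is an isomorphism in $\mathrm{G}\mathbb{M}\mathrm{od}^0\text{-}\mathcal{B}$ if and only if $f^0:M\to N$ is an isomorphism of graded right $S$-modules.
   Context: Conventions: $k$ is a field, $S$ is a finite-dimensional semisimple $k$-algebra such that $S\otimes_kS^{op}$ is semisimple; $k$ acts centrally on all algebras and bimodules; $S$ is graded concentrated in degree $0$. Graded means $\mathbb{Z}$-graded. A homogeneous morphism $f:M\to N$ of degree $d$ of graded right $S$-modules is an $S$-linear map with $f(M_j)\subseteq N_{j+d}$ for all $j$; write $|f|=d$. Tensor products over $S$ carry the usual grading, and $(f\otimes g)(x\otimes y)=(-1)^{|g||x|}f(x)\otimes g(y)$. A differential graded $S$-bocs is $\mathcal{B}=(C,\mu,\epsilon,\delta)$ with $C$ a graded $S$-$S$-bimodule, $\mu:C\to C\otimes_SC$ and $\epsilon:C\to S$ degree $0$ bimodule maps making $C$ coassociative and counital, and $\delta:C\to C$ a degree $1$ bimodule map with $\mu\delta=(id_C\otimes\delta+\delta\otimes id_C)\mu$ and $\delta^2=0$. It is normal if there is a bimodule decomposition $C=S\oplus\overline{C}$ such that $\epsilon$ is the projection on $S$ and $\mu(1)=1\otimes1$. Then $\overline{\mu}(x)=\mu(x)-1\otimes x-x\otimes 1$ defines a map $\overline{\mu}:\overline{C}\to\overline{C}\otimes_S\overline{C}$ and $\delta$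 restricts to $\overline{\delta}:\overline{C}\to\overline{C}$. A triangular graded $S$-bocs is a normal one for which there is a chain $0=\overline{C}_0\subseteq\overline{C}_1\subseteq\cdots$ of graded $S$-$S$-subbimodules of $\overline{C}$ with $\overline{C}=\bigcup_i\overline{C}_i$ and, for all $i\ge1$, $\overline{\mu}(\overline{C}_i)\subseteq\overline{C}_{i-1}\otimes_S\overline{C}_{i-1}$ and $\overline{\delta}(\overline{C}_i)\subseteq\overline{C}_i$. The category $\mathrm{G}\mathbb{M}\mathrm{od}^0\text{-}\mathcal{B}$ has as objects the graded right $S$-modules; a morphism $M\to N$ is a pair $(f^0,f^1)$ of degree $0$ homogeneous morphisms of right $S$-modules $f^0:M\to N$ and $f^1:M\otimes_S\overline{C}\to N$. Composition: $(g*f)^0=g^0f^0$ and $(g*f)^1=g^1(f^0\otimes id_{\overline{C}})+g^0f^1+g^1(f^1\otimes id_{\overline{C}})(id_M\otimes\overline{\mu})$. The identity of $M$ is $(id_M,0)$. *)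

(* Defs.v *)
From HB Require Import structures.
From mathcomp Require Import all_boot all_order all_algebra all_field.
From mathcomp Require Import boolp.
From mathcomp.multinomials Require Import freeg.

Set Implicit Arguments.
Unset Strict Implicit.
Unset Printing Implicit Defensive.

Import GRing.Theory.
Local Open Scope ring_scope.
Local Open Scope quotient_scope.

Section TensorGroup.
Variables (R : Type) (M N : zmodType) (ra : M -> R -> M) (la : R -> N -> N).

Let single (x : M) (y : N) : {freeg (M * N)} := << (x, y) >>.

(* The subgroup of the free abelian group on M * N generated by the bilinearity
   and balancing relations; the quotient by it is the tensor product over R. *)
Inductive tens_null : {freeg (M * N)} -> Prop :=
| tens_null0 : tens_null 0
| tens_nullB u v : tens_null u -> tens_null v -> tens_null (u - v)
| tens_null_addl x x' y :
    tens_null (single (x + x') y - (single x y + single x' y))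
| tens_null_addr x y y' :
    tens_null (single x (y + y') - (single x y + single x y'))
| tens_null_bal x a y : tens_null (single (ra x a) y - single x (la a y)).

Definition tens_null_pred : {pred {freeg (M * N)}} := fun z => `[< tens_null z >].

Lemma tens_null_zmod : zmod_closed tens_null_pred.
Proof.
split; first by apply/asboolP; constructor.
by move=> u v /asboolP hu /asboolP hv; apply/asboolP; constructor.
Qed.
HB.instance Definition _ :=
  GRing.isZmodClosed.Build {freeg (M * N)} tens_null_pred tens_null_zmod.

Definition tens := Quotient.quot tens_null_pred.
HB.instance Definition _ := GRing.Zmodule.on tens.

Definition pure (x : M) (y : N) : tens := \pi_(Quotient.quot tens_null_pred) (single x y).

Lemma tens_eq (u v : {freeg (M * N)}) : tens_null (u - v) ->
  \pi_(Quotient.quot tens_null_pred) u = \pi_(Quotient.quot tens_null_pred) v.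
Proof. by move=> h; apply/eqP; rewrite -Quotient.idealrBE; apply/asboolP. Qed.

Lemma pureDl x x' y : pure (x + x') y = pure x y + pure x' y.
Proof. by rewrite -[RHS]pi_addr; apply: tens_eq; constructor. Qed.

Lemma pureDr x y y' : pure x (y + y') = pure x y + pure x y'.
Proof. by rewrite -[RHS]pi_addr; apply: tens_eq; constructor. Qed.

Lemma pure_bal x a y : pure (ra x a) y = pure x (la a y).
Proof. by apply: tens_eq; constructor. Qed.

Lemma pure0l y : pure 0 y = 0.
Proof. by apply: (addrI (pure 0 y)); rewrite -pureDl !addr0. Qed.

Lemma pure0r x : pure x 0 = 0.
Proof. by apply: (addrI (pure x 0)); rewrite -pureDr !addr0. Qed.

Lemma pureNl x y : pure (- x) y = - pure x y.
Proof. by apply: (addrI (pure x y)); rewrite -pureDl !subrr pure0l. Qed.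

Lemma pure_suml (I : Type) (s : seq I) (F : I -> M) y :
  pure (\sum_(i <- s) F i) y = \sum_(i <- s) pure (F i) y.
Proof. exact: (big_morph (pure^~ y) (fun a b => pureDl a b y) (pure0l y)). Qed.

Lemma pure_sumr (I : Type) (s : seq I) x (F : I -> N) :
  pure x (\sum_(i <- s) F i) = \sum_(i <- s) pure x (F i).
Proof. exact: (big_morph (pure x) (pureDr x) (pure0r x)). Qed.

Lemma tens_ind (P : tens -> Prop) :
  (forall x y, P (pure x y)) -> (forall s t, P s -> P t -> P (s + t)) ->
  forall t, P t.
Proof.
move=> Pp PD t.
have P0 : P 0 by rewrite -(pure0l 0).
have PN n x y : P (pure x y *+ n).
  by elim: n => [|n ih]; rewrite ?mulr0n // mulrS; apply: PD.
have -> : t = \pi_(Quotient.quot tens_null_pred) (repr t) by rewrite reprK.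
rewrite -(freeg_sumE (repr t)).
elim: (dom _) => [|[x y] s ih].
  by rewrite big_nil (raddf0 \pi_(Quotient.quot tens_null_pred)).
rewrite big_cons (raddfD \pi_(Quotient.quot tens_null_pred)); apply: PD ih.
have -> : << coeff (x, y) (repr t) *g (x, y) >> = single x y *~ coeff (x, y) (repr t).
  by rewrite /single freegU_mulz intz.
case: (coeff _ _) => n.
  by rewrite -pmulrn (raddfMn \pi_(Quotient.quot tens_null_pred)); apply: PN.
rewrite NegzE mulrNz -pmulrn (raddfN \pi_(Quotient.quot tens_null_pred)).
rewrite (raddfMn \pi_(Quotient.quot tens_null_pred)) -mulNrn -[- _]pureNl.
exact: PN.
Qed.

Record balanced (A : zmodType) (phi : M -> N -> A) : Prop := Balanced {
  balancedDl : forall x x' y, phi (x + x') y = phi x y + phi x' y;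
  balancedDr : forall x y y', phi x (y + y') = phi x y + phi x y';
  balanced_bal : forall x a y, phi (ra x a) y = phi x (la a y) }.

Section Lift.
Variables (A : zmodType) (phi : M -> N -> A).

Definition tens_lift (t : tens) : A :=
  fglift (fun p => phi p.1 p.2 : zmodule A) (repr t).

Hypothesis phiP : balanced phi.

Let lft : {freeg (M * N)} -> zmodule A := fglift (fun p => phi p.1 p.2 : zmodule A).

Let lftB : {morph lft : x y / x - y}.
Proof. exact: lift_is_additive. Qed.

Let lft0 : lft 0 = 0.
Proof. by rewrite -[0 in LHS](subrr 0) lftB subrr. Qed.

Let lftD : {morph lft : x y / x + y}.
Proof. by move=> x y; rewrite -{1}[y]opprK lftB -[- y]sub0r lftB lft0 sub0r opprK. Qed.

Lemma tens_lift_pi u :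
  tens_lift (\pi_(Quotient.quot tens_null_pred) u) = lft u.
Proof.
have lftU x y : lft (single x y) = phi x y by rewrite /lft liftU scale1r.
have ker z : tens_null z -> lft z = 0.
  elim=> [|v w _ hv _ hw|x x' y|x y y'|x a y].
  - exact: lft0.
  - by rewrite lftB hv hw subr0.
  - by rewrite lftB lftD !lftU (balancedDl phiP); apply: subrr.
  - by rewrite lftB lftD !lftU (balancedDr phiP); apply: subrr.
  - by rewrite lftB !lftU (balanced_bal phiP); apply: subrr.
apply/eqP; rewrite -subr_eq0; apply/eqP; rewrite -[LHS]lftB; apply: ker.
apply/asboolP; rewrite -[`[< _ >]]/(_ \in tens_null_pred) Quotient.idealrBE.
by rewrite reprK.
Qed.

Lemma tens_lift_pure x y : tens_lift (pure x y) = phi x y.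
Proof. by rewrite tens_lift_pi /lft liftU scale1r. Qed.

Lemma tens_liftD s t : tens_lift (s + t) = tens_lift s + tens_lift t.
Proof.
rewrite -[s]reprK -[t]reprK -[_ + _]pi_addr !tens_lift_pi.
exact: lftD.
Qed.
End Lift.

Lemma tens_ext (A : zmodType) (f g : tens -> A) :
  (forall s t, f (s + t) = f s + f t) -> (forall s t, g (s + t) = g s + g t) ->
  (forall x y, f (pure x y) = g (pure x y)) -> f =1 g.
Proof.
by move=> fD gD fg; apply: tens_ind => // s t hs ht; rewrite fD gD hs ht.
Qed.

End TensorGroup.

Definition semisimple_module (R : pzRingType) (M : lmodType R) : Prop :=
  forall U : {pred M}, GRing.submod_closed U ->
  exists V : {pred M}, [/\ GRing.submod_closed V,
    forall x, x \in U -> x \in V -> x = 0 &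
    forall x, exists u v, [/\ u \in U, v \in V & x = u + v]].

Definition semisimple_ring (R : pzRingType) : Prop := semisimple_module (R^o).

Section Envelope.
Variables (k : fieldType) (S : falgType k).

(* The enveloping algebra S \otimes_k S^op, whose product is
   (a \otimes b)(a' \otimes b') = aa' \otimes b'b. *)
Definition envelope : Type :=
  tens (fun (x : S) (c : k) => c *: x) (fun (c : k) (y : S) => c *: y).
HB.instance Definition _ := GRing.Zmodule.on envelope.

Definition epure (a b : S) : envelope := pure _ _ a b.

Let row (a b : S) : envelope -> envelope :=
  tens_lift (fun a' b' => epure (a * a') (b' * b)).

Let row_bal a b : balanced (fun (x : S) (c : k) => c *: x)
  (fun (c : k) (y : S) => c *: y) (fun a' b' => epure (a * a') (b' * b)).
Proof.
split=> [x x' y|x y y'|x c y].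
- by rewrite mulrDr [LHS]pureDl.
- by rewrite mulrDl [LHS]pureDr.
- by rewrite -scalerAr -scalerAl [LHS]pure_bal.
Qed.

Let rowD a b s t : row a b (s + t) = row a b s + row a b t.
Proof. exact: (tens_liftD (row_bal a b)). Qed.
Let row_pure a b a' b' : row a b (epure a' b') = epure (a * a') (b' * b).
Proof. exact: (tens_lift_pure (row_bal a b)). Qed.

Definition emul (s t : envelope) : envelope :=
  tens_lift (fun a b => row a b t) s.

Let emul_bal t : balanced (fun (x : S) (c : k) => c *: x)
  (fun (c : k) (y : S) => c *: y) (fun a b => row a b t).
Proof.
split=> [x x' y|x y y'|x c y]; elim/tens_ind: t => [a b|s t ihs iht];
  rewrite ?rowD ?ihs ?iht ?row_pure //; try by rewrite addrACA.
- by rewrite mulrDl [LHS]pureDl.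
- by rewrite mulrDr [LHS]pureDr.
- by rewrite -scalerAl -scalerAr [LHS]pure_bal.
Qed.

Lemma emulDl : left_distributive emul +%R.
Proof. by move=> s t u; apply: (tens_liftD (emul_bal u)). Qed.

Lemma emul_epure a b a' b' :
  emul (epure a b) (epure a' b') = epure (a * a') (b' * b).
Proof. by rewrite [LHS](tens_lift_pure (emul_bal _)) row_pure. Qed.

Lemma emulDr : right_distributive emul +%R.
Proof.
move=> s t u; elim/tens_ind: s => [a b|s1 s2 h1 h2].
  by rewrite /emul !(tens_lift_pure (emul_bal _)) rowD.
by rewrite !emulDl h1 h2 addrACA.
Qed.

Lemma emulA : associative emul.
Proof.
move=> s t u; elim/tens_ind: s => [a b|s1 s2 h1 h2]; last by rewrite !emulDl h1 h2.
elim/tens_ind: t => [a' b'|t1 t2 h1 h2].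
  elim/tens_ind: u => [c d|u1 u2 h1 h2]; last by rewrite !emulDr h1 h2.
  by rewrite -!/(epure _ _) !emul_epure !mulrA.
by rewrite emulDl !emulDr emulDl h1 h2.
Qed.

Lemma emul1l : left_id (epure 1 1) emul.
Proof.
elim/tens_ind => [a b|s t hs ht]; last by rewrite emulDr hs ht.
by rewrite -!/(epure _ _) emul_epure mul1r mulr1.
Qed.

Lemma emul1r : right_id (epure 1 1) emul.
Proof.
elim/tens_ind => [a b|s t hs ht]; last by rewrite emulDl hs ht.
by rewrite -!/(epure _ _) emul_epure mul1r mulr1.
Qed.

HB.instance Definition _ := GRing.Zmodule_isPzRing.Build envelope
  emulA emul1l emul1r emulDl emulDr.
End Envelope.

(* Right R-modules are left modules over the converse ring R^c. *)
Definition ract (R : pzRingType) (M : lmodType R^c) (x : M) (a : R) : M :=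
  (a : R^c) *: x.

HB.mixin Record isBimodule (k : fieldType) (S : falgType k) B
    of GRing.Lmodule S^c B := {
  lact : S -> B -> B;
  lactA : forall a b x, lact a (lact b x) = lact (a * b) x;
  lact1 : forall x, lact 1 x = x;
  lactDl : forall a b x, lact (a + b) x = lact a x + lact b x;
  lactDr : forall a x y, lact a (x + y) = lact a x + lact a y;
  lact_ract : forall a b x, lact a (ract x b) = ract (lact a x) b;
  lact_central : forall (c : k) x, lact c%:A x = ract x c%:A }.

#[short(type="bimodType")]
HB.structure Definition Bimodule (k : fieldType) (S : falgType k) :=
  {B of GRing.Lmodule S^c B & isBimodule k S B}.

(* Gradings by the integers; the ring itself sits in degree 0, so the
   homogeneous components are submodules. *)
HB.mixin Record isGraded (R : pzRingType) M of GRing.Lmodule R M := {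
  gcomp : int -> {pred M};
  gcomp_submod : forall i, GRing.submod_closed (gcomp i);
  gcomp_span : forall x, exists s : seq (int * M),
    (forall p, p \in s -> p.2 \in gcomp p.1) /\ x = \sum_(p <- s) p.2;
  gcomp_indep : forall (s : seq int) (y : int -> M), uniq s ->
    (forall i, y i \in gcomp i) -> \sum_(i <- s) y i = 0 ->
    forall i, i \in s -> y i = 0 }.

#[short(type="gmodType")]
HB.structure Definition GradedModule (R : pzRingType) :=
  {M of GRing.Lmodule R M & isGraded R M}.

HB.mixin Record isGradedBimodule (k : fieldType) (S : falgType k) B
    of Bimodule k S B & GradedModule S^c B := {
  lact_gcomp : forall (a : S) i (x : B), x \in @gcomp S^c B i ->
    lact a x \in @gcomp S^c B i }.

#[short(type="gbimodType")]
HB.structure Definition GradedBimodule (k : fieldType) (S : falgType k) :=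
  {B of Bimodule k S B & GradedModule S^c B & isGradedBimodule k S B}.

Section Homogeneous.
Variables (R : pzRingType) (M : gmodType R).
Implicit Types (x y : M) (i j : int).

Lemma gcomp0 i : (0 : M) \in gcomp i.
Proof. by case: (@gcomp_submod R M i). Qed.

Lemma gcompDZ i a x y : x \in gcomp i -> y \in gcomp i -> a *: x + y \in gcomp i.
Proof. by case: (@gcomp_submod R M i) => _ h hx hy; apply: h. Qed.

Lemma gcompD i x y : x \in gcomp i -> y \in gcomp i -> x + y \in gcomp i.
Proof. by move=> hx hy; rewrite -[x]scale1r; apply: gcompDZ. Qed.

Lemma gcompZ i a x : x \in gcomp i -> a *: x \in gcomp i.
Proof. by move=> hx; rewrite -[_ *: _]addr0; apply: gcompDZ => //; apply: gcomp0. Qed.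

Lemma gcompN i x : x \in gcomp i -> - x \in gcomp i.
Proof. by rewrite -scaleN1r; apply: gcompZ. Qed.

Lemma gcomp_sum (I : eqType) (s : seq I) (P : pred I) (F : I -> M) i :
  (forall l, l \in s -> P l -> F l \in gcomp i) ->
  \sum_(l <- s | P l) F l \in gcomp i.
Proof.
move=> h; rewrite big_seq_cond; elim/big_ind: _ => //; first exact: gcomp0.
  exact: gcompD.
by move=> l /andP[]; apply: h.
Qed.

Lemma sum_subset (A : zmodType) (s s' : seq int) (F : int -> A) :
  uniq s -> uniq s' -> {subset s <= s'} -> (forall i, i \notin s -> F i = 0) ->
  \sum_(i <- s') F i = \sum_(i <- s) F i.
Proof.
move=> us us' ss' F0; rewrite (bigID (mem s)) /= [X in _ + X]big1 ?addr0.
  rewrite -big_filter; apply: perm_big; apply: uniq_perm; rewrite ?filter_uniq //.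
  by move=> i; rewrite mem_filter; case: (boolP (i \in s)) => //= /ss'.
by move=> i; apply: F0.
Qed.

Lemma gdecP x : exists d : seq int * (int -> M), [/\ uniq d.1,
  forall i, d.2 i \in gcomp i, forall i, i \notin d.1 -> d.2 i = 0 &
  x = \sum_(i <- d.1) d.2 i].
Proof.
have [s [hs ->]] := gcomp_span x.
exists (undup (map fst s), fun i => \sum_(p <- s | p.1 == i) p.2); split=> /=.
- exact: undup_uniq.
- by move=> i; apply: gcomp_sum => p ps /eqP <-; apply: hs.
- move=> i; rewrite mem_undup => hi; rewrite big_seq_cond big1 // => p.
  by case/andP=> ps /eqP pi; rewrite -pi map_f in hi.
- rewrite (exchange_big_dep predT) //= !big_seq; apply: eq_bigr => p ps.
  rewrite -big_filter (_ : filter _ _ = [:: p.1]) ?big_seq1 //.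
  rewrite -(filter_pred1_uniq (undup_uniq (map fst s))) ?mem_undup ?map_f //.
  by apply: eq_filter => i; rewrite eq_sym.
Qed.

Definition gsupp x : seq int := (projT1 (cid (gdecP x))).1.
Definition gproj i x : M := (projT1 (cid (gdecP x))).2 i.

Lemma gsupp_uniq x : uniq (gsupp x).
Proof. by rewrite /gsupp; case: cid => d []. Qed.
Lemma gproj_gcomp i x : gproj i x \in gcomp i.
Proof. by rewrite /gproj; case: cid => d []. Qed.
Lemma gproj_supp i x : i \notin gsupp x -> gproj i x = 0.
Proof. by rewrite /gproj /gsupp; case: cid => d /= [_ _ + _]; apply. Qed.
Lemma gproj_sum x : x = \sum_(i <- gsupp x) gproj i x.
Proof. by rewrite {1}/gsupp; rewrite /gproj; case: cid => d []. Qed.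

Lemma gproj_unique (s : seq int) (y : int -> M) x : uniq s ->
  (forall i, y i \in gcomp i) -> (forall i, i \notin s -> y i = 0) ->
  x = \sum_(i <- s) y i -> forall i, gproj i x = y i.
Proof.
move=> us hy y0 ex i; pose s' := undup (s ++ gsupp x).
have us' : uniq s' by apply: undup_uniq.
case: (boolP (i \in s')) => [hi|]; last first.
  by rewrite mem_undup mem_cat => /norP[/y0 -> /gproj_supp ->].
apply/eqP; rewrite -subr_eq0; apply/eqP.
apply: (@gcomp_indep _ M s' (fun i => gproj i x - y i)) => //.
- by move=> j; apply: gcompD; [apply: gproj_gcomp|apply: gcompN].
- rewrite big_split sumrN /= (sum_subset (gsupp_uniq x)) -?gproj_sum //.
  + rewrite (sum_subset us) -?ex ?subrr // => j.
    by rewrite mem_undup mem_cat => ->.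
  + by move=> j; rewrite mem_undup mem_cat orbC => ->.
  + by move=> j; apply: gproj_supp.
Qed.

Lemma gproj_id i j x : x \in gcomp j -> gproj i x = if i == j then x else 0.
Proof.
move=> hx; apply: (@gproj_unique [:: j] (fun i => if i == j then x else 0)) => //.
- by move=> l; case: eqP => [->//|_]; apply: gcomp0.
- by move=> l; rewrite inE => /negPf ->.
- by rewrite big_seq1 eqxx.
Qed.

Lemma gproj_lin i a x y : gproj i (a *: x + y) = a *: gproj i x + gproj i y.
Proof.
pose s := undup (gsupp x ++ gsupp y).
have us : uniq s by apply: undup_uniq.
apply: (@gproj_unique s (fun i => a *: gproj i x + gproj i y)) => //.
- by move=> j; apply: gcompDZ; apply: gproj_gcomp.
- move=> j; rewrite mem_undup mem_cat => /norP[hx hy].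
  by rewrite !gproj_supp // scaler0 addr0.
- rewrite big_split -scaler_sumr /= (sum_subset (gsupp_uniq x)) -?gproj_sum //.
  + rewrite (sum_subset (gsupp_uniq y)) -?gproj_sum //.
      by move=> j; rewrite mem_undup mem_cat orbC => ->.
    by move=> j; apply: gproj_supp.
  + by move=> j; rewrite mem_undup mem_cat => ->.
  + by move=> j; apply: gproj_supp.
Qed.

Lemma gprojD i x y : gproj i (x + y) = gproj i x + gproj i y.
Proof. by have := gproj_lin i 1 x y; rewrite !scale1r. Qed.
Lemma gprojZ i a x : gproj i (a *: x) = a *: gproj i x.
Proof.
have p0 : gproj i 0 = 0 by rewrite (gproj_id i (gcomp0 0)) if_same.
by have := gproj_lin i a x 0; rewrite p0 !addr0.
Qed.

Lemma sum_gsupp (A : zmodType) (F : int -> M -> A) (s : seq int) x :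
  (forall i, F i 0 = 0) -> uniq s -> {subset gsupp x <= s} ->
  \sum_(i <- s) F i (gproj i x) = \sum_(i <- gsupp x) F i (gproj i x).
Proof.
move=> F0 us hs; apply: sum_subset => //; first exact: gsupp_uniq.
by move=> i hi; rewrite gproj_supp.
Qed.

(* gsum F sends a sum of homogeneous elements x_i of degree i to the sum
   of the F i x_i. *)
Definition gsum (A : zmodType) (F : int -> M -> A) x : A :=
  \sum_(i <- gsupp x) F i (gproj i x).

Lemma gsum_homog (A : zmodType) (F : int -> M -> A) i x :
  (forall i, F i 0 = 0) -> x \in gcomp i -> gsum F x = F i x.
Proof.
move=> F0 hx; pose s := undup (i :: gsupp x).
have us : uniq s by apply: undup_uniq.
rewrite /gsum -(@sum_gsupp _ F s) //; last by move=> j hj; rewrite mem_undup inE hj orbT.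
rewrite (bigD1_seq i) ?mem_undup ?mem_head //= (gproj_id i hx) eqxx big1 ?addr0 //.
by move=> j /negPf ji; rewrite (gproj_id j hx) ji F0.
Qed.

Lemma gsumD (A : zmodType) (F : int -> M -> A) x y :
  (forall i x y, F i (x + y) = F i x + F i y) -> gsum F (x + y) = gsum F x + gsum F y.
Proof.
move=> FD; have F0 i : F i 0 = 0 by apply: (addrI (F i 0)); rewrite -FD !addr0.
pose s := undup (gsupp (x + y) ++ gsupp x ++ gsupp y).
have us : uniq s by apply: undup_uniq.
rewrite /gsum -!(@sum_gsupp _ F s) //;
  try by move=> j hj; rewrite mem_undup !mem_cat hj ?orbT.
by rewrite -big_split; apply: eq_bigr => i _ /=; rewrite gprojD FD.
Qed.
End Homogeneous.

Section RAct.
Variables (R : pzRingType) (M : lmodType R^c).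
Implicit Types (x y : M) (a b : R).

Lemma ractDl x a b : ract x (a + b) = ract x a + ract x b.
Proof. exact: scalerDl. Qed.
Lemma ractDr x y a : ract (x + y) a = ract x a + ract y a.
Proof. exact: scalerDr. Qed.
Lemma ractA x a b : ract (ract x a) b = ract x (a * b).
Proof. exact: scalerA. Qed.
Lemma ract1 x : ract x 1 = x.
Proof. exact: scale1r. Qed.
End RAct.

Definition homogeneous (R : pzRingType) (M N : gmodType R) (d : int) (f : M -> N) : Prop :=
  forall j x, x \in gcomp j -> f x \in gcomp (j + d).

Record ghom (R : pzRingType) (M N : gmodType R) := GHom {
  ghom_fun :> {linear M -> N};
  ghom_deg : homogeneous 0 ghom_fun }.

Definition ghom_iso (R : pzRingType) (M N : gmodType R) (f : ghom M N) : Prop :=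
  exists g : ghom N M, cancel f g /\ cancel g f.

Section Bocses.
Variables (k : fieldType) (S : falgType k).

Section TensorModule.
Variables (M : lmodType S^c) (B : bimodType S).

Definition tensor : Type := tens (@ract S M) (@lact k S B).
HB.instance Definition _ := GRing.Zmodule.on tensor.

Definition tpure (x : M) (y : B) : tensor := pure _ _ x y.

Definition tbalanced (A : zmodType) (phi : M -> B -> A) : Prop :=
  balanced (@ract S M) (@lact k S B) phi.

Definition tlift (A : zmodType) (phi : M -> B -> A) (t : tensor) : A :=
  tens_lift phi t.

Lemma tensor_ind (P : tensor -> Prop) :
  (forall x y, P (tpure x y)) -> (forall s t, P s -> P t -> P (s + t)) ->
  forall t, P t.
Proof. exact: tens_ind. Qed.

Lemma tpureDl x x' y : tpure (x + x') y = tpure x y + tpure x' y.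
Proof. exact: pureDl. Qed.
Lemma tpureDr x y y' : tpure x (y + y') = tpure x y + tpure x y'.
Proof. exact: pureDr. Qed.
Lemma tpure_bal x a y : tpure (ract x a) y = tpure x (lact a y).
Proof. exact: pure_bal. Qed.
Lemma tpure0l y : tpure 0 y = 0.
Proof. exact: pure0l. Qed.
Lemma tpure0r x : tpure x 0 = 0.
Proof. exact: pure0r. Qed.

Lemma tlift_pure (A : zmodType) (phi : M -> B -> A) x y :
  tbalanced phi -> tlift phi (tpure x y) = phi x y.
Proof. by move=> h; apply: tens_lift_pure. Qed.
Lemma tliftD (A : zmodType) (phi : M -> B -> A) s t :
  tbalanced phi -> tlift phi (s + t) = tlift phi s + tlift phi t.
Proof. by move=> h; apply: tens_liftD. Qed.

Definition tscale (a : S^c) : tensor -> tensor :=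
  tlift (fun x y => tpure x (a *: y)).

Let tscale_bal a : tbalanced (fun x y => tpure x (a *: y)).
Proof.
split=> [x x' y|x y y'|x b y]; first exact: tpureDl.
  by rewrite scalerDr tpureDr.
by rewrite tpure_bal -[a *: lact b y]/(ract (lact b y) a) -lact_ract.
Qed.

Lemma tscale_pure a x y : tscale a (tpure x y) = tpure x (a *: y).
Proof. exact: (tlift_pure _ _ (tscale_bal a)). Qed.

Lemma tscaleDr : right_distributive tscale +%R.
Proof. by move=> a s t; apply: (tliftD _ _ (tscale_bal a)). Qed.

Lemma tscaleA a b t : tscale a (tscale b t) = tscale (a * b) t.
Proof.
elim/tensor_ind: t => [x y|s t hs ht]; last by rewrite !tscaleDr hs ht.
by rewrite !tscale_pure scalerA.
Qed.

Lemma tscale1 : left_id 1 tscale.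
Proof.
elim/tensor_ind => [x y|s t hs ht]; last by rewrite tscaleDr hs ht.
by rewrite tscale_pure scale1r.
Qed.

Lemma tscaleDl t : {morph tscale^~ t : a b / a + b}.
Proof.
move=> a b /=; elim/tensor_ind: t => [x y|s t hs ht].
  by rewrite !tscale_pure scalerDl tpureDr.
by rewrite !tscaleDr hs ht addrACA.
Qed.

HB.instance Definition _ := GRing.Zmodule_isLmodule.Build S^c tensor
  tscaleA tscale1 tscaleDr tscaleDl.

Lemma tpureZ a x y : a *: tpure x y = tpure x (a *: y).
Proof. exact: tscale_pure. Qed.
End TensorModule.

Section TensorBimodule.
Variables (A B : bimodType S).
Local Notation T := (tensor A B).

Definition tlact (a : S) : T -> T := tlift (fun x y => tpure (lact a x) y).

Let tlact_bal a : tbalanced (fun (x : A) (y : B) => tpure (lact a x) y).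
Proof.
split=> [x x' y|x y y'|x b y]; last by rewrite lact_ract tpure_bal.
  by rewrite lactDr tpureDl.
exact: tpureDr.
Qed.

Lemma tlact_pure a x y : tlact a (tpure x y) = tpure (lact a x) y.
Proof. exact: (tlift_pure _ _ (tlact_bal a)). Qed.

Lemma tlactDr a s t : tlact a (s + t) = tlact a s + tlact a t.
Proof. exact: (tliftD _ _ (tlact_bal a)). Qed.

Lemma tlactA a b t : tlact a (tlact b t) = tlact (a * b) t.
Proof.
elim/tensor_ind: t => [x y|s t hs ht]; last by rewrite !tlactDr hs ht.
by rewrite !tlact_pure lactA.
Qed.

Lemma tlact1 t : tlact 1 t = t.
Proof.
elim/tensor_ind: t => [x y|s t hs ht]; last by rewrite !tlactDr hs ht.
by rewrite tlact_pure lact1.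
Qed.

Lemma tlactDl a b t : tlact (a + b) t = tlact a t + tlact b t.
Proof.
elim/tensor_ind: t => [x y|s t hs ht]; last by rewrite !tlactDr hs ht addrACA.
by rewrite !tlact_pure lactDl tpureDl.
Qed.

Lemma tlact_ract a b t : tlact a (ract t b) = ract (tlact a t) b.
Proof.
elim/tensor_ind: t => [x y|s t hs ht].
  by rewrite /ract tpureZ !tlact_pure tpureZ.
by rewrite ractDr !tlactDr hs ht ractDr.
Qed.

Lemma tlact_central (c : k) t : tlact c%:A t = ract t c%:A.
Proof.
elim/tensor_ind: t => [x y|s t hs ht]; last by rewrite tlactDr hs ht ractDr.
by rewrite tlact_pure lact_central tpure_bal lact_central /ract tpureZ.
Qed.

HB.instance Definition _ := isBimodule.Build k S T
  tlactA tlact1 tlactDl tlactDr tlact_ract tlact_central.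

Lemma lact_tpure a x y : lact a (tpure x y : T) = tpure (lact a x) y.
Proof. exact: tlact_pure. Qed.
End TensorBimodule.

Section TensorGrading.
Variables (M : gmodType S^c) (B : gbimodType S).
Local Notation T := (tensor M B).

(* Degree n is spanned by the x \otimes y with x, y homogeneous of degrees
   adding up to n. *)
Definition tgcomp (n : int) : {pred T} := fun t => `[< exists s : seq (M * B),
  (forall p, p \in s -> exists i, p.1 \in gcomp i /\ p.2 \in gcomp (n - i)) /\
  t = \sum_(p <- s) tpure p.1 p.2 >].

Lemma tgcomp_pure i j (x : M) (y : B) :
  x \in gcomp i -> y \in gcomp j -> tpure x y \in tgcomp (i + j).
Proof.
move=> hx hy; apply/asboolP; exists [:: (x, y)]; rewrite big_seq1; split=> // p.
by rewrite inE => /eqP -> /=; exists i; rewrite [i + j]addrC addrK.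
Qed.

Lemma tgcompD n s t : s \in tgcomp n -> t \in tgcomp n -> s + t \in tgcomp n.
Proof.
move=> /asboolP[u [hu ->]] /asboolP[v [hv ->]]; apply/asboolP.
exists (u ++ v); rewrite big_cat; split=> // p.
by rewrite mem_cat => /orP[/hu|/hv].
Qed.

Lemma tgcomp0 n : 0 \in tgcomp n.
Proof. by apply/asboolP; exists [::]; rewrite big_nil. Qed.

Lemma tgcomp_ind n (P : T -> Prop) : P 0 ->
  (forall i (x : M) (y : B), x \in gcomp i -> y \in gcomp (n - i) -> P (tpure x y)) ->
  (forall s t, P s -> P t -> P (s + t)) -> forall t, t \in tgcomp n -> P t.
Proof.
move=> P0 Pp PD t /asboolP[s [hs ->]]; rewrite big_seq.
elim/big_ind: _ => // p /hs[i [h1 h2]]; exact: Pp h1 h2.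
Qed.

Lemma tgcomp_submod n : GRing.submod_closed (tgcomp n).
Proof.
split; first exact: tgcomp0.
move=> a s t hs ht; apply: tgcompD ht; move: s hs.
apply: tgcomp_ind => [|i x y hx hy|u v hu hv].
- by rewrite scaler0; apply: tgcomp0.
- rewrite tpureZ; have -> : n = i + (n - i) by rewrite addrC addrNK.
  by apply: tgcomp_pure => //; apply: gcompZ.
- by rewrite scalerDr; apply: tgcompD.
Qed.

Lemma tgcomp_span (t : T) : exists s : seq (int * T),
  (forall p, p \in s -> p.2 \in tgcomp p.1) /\ t = \sum_(p <- s) p.2.
Proof.
elim/tensor_ind: t => [x y|s t [u [hu ->]] [v [hv ->]]]; last first.
  exists (u ++ v); rewrite big_cat; split=> // p.
  by rewrite mem_cat => /orP[/hu|/hv].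
exists [seq (i + j, tpure (gproj i x) (gproj j y)) | i <- gsupp x, j <- gsupp y].
split=> [p /allpairsP[[i j] [_ _ ->]] /=|].
  by apply: tgcomp_pure; apply: gproj_gcomp.
rewrite big_allpairs_dep /= {1}[x]gproj_sum {1}[y]gproj_sum [LHS]pure_suml.
by apply: eq_bigr => i _; rewrite [LHS]pure_sumr.
Qed.

Let tproj (n : int) : T -> T :=
  tlift (fun x y => gsum (fun i x' => tpure x' (gproj (n - i) y)) x).

Let tproj_bal n :
  tbalanced (fun (x : M) (y : B) => gsum (fun i x' => tpure x' (gproj (n - i) y)) x).
Proof.
split=> [x x' y|x y y'|x a y].
- by apply: gsumD => i u v; apply: tpureDl.
- by rewrite /gsum -big_split; apply: eq_bigr => i _; rewrite gprojD tpureDr.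
rewrite [x]gproj_sum.
have rs : ract (\sum_(i <- gsupp x) gproj i x) a =
    \sum_(i <- gsupp x) ract (gproj i x) a by apply: scaler_sumr.
have gs F : (forall i x y, F i (x + y) = F i x + F i y :> T) ->
    forall (z : int -> M) s, gsum F (\sum_(i <- s) z i) = \sum_(i <- s) gsum F (z i).
  move=> FD z s; apply: (big_morph (gsum F)) => [u v|]; first exact: gsumD.
  by apply: (addrI (gsum F 0)); rewrite -gsumD ?addr0.
rewrite rs !gs; try by move=> *; apply: tpureDl.
apply: eq_bigr => i _; have hi := gproj_gcomp i x.
rewrite !(@gsum_homog _ _ _ _ i) //; try by move=> *; apply: tpure0l.
  rewrite tpure_bal; congr tpure; apply/esym.
  have [s hs] : exists s, y = \sum_(j <- s) gproj j y by exists (gsupp y); apply: gproj_sum.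
  apply: (@gproj_unique _ _ (gsupp y) (fun j => lact a (gproj j y))).
  - exact: gsupp_uniq.
  - by move=> j; apply/lact_gcomp/gproj_gcomp.
  - by move=> j /gproj_supp ->; apply: (addrI (lact a 0)); rewrite -lactDr !addr0.
  - rewrite {1}[y]gproj_sum; apply: (big_morph (lact a)) => [u v|]; first exact: lactDr.
    by apply: (addrI (lact a 0)); rewrite -lactDr !addr0.
by apply: gcompZ.
Qed.

Let tprojD n s t : tproj n (s + t) = tproj n s + tproj n t.
Proof. exact: (tliftD _ _ (tproj_bal n)). Qed.

Let tproj0 n : tproj n 0 = 0.
Proof. by apply: (addrI (tproj n 0)); rewrite -tprojD !addr0. Qed.

Let tproj_id n m t : t \in tgcomp m -> tproj n t = if n == m then t else 0.
Proof.
move: t; apply: tgcomp_ind => [|i x y hx hy|s t hs ht].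
- by rewrite tproj0 if_same.
- rewrite [LHS](tlift_pure _ _ (tproj_bal n)) (gsum_homog _ hx) ?tpure0l //; last first.
    by move=> j; apply: tpure0l.
  by rewrite (gproj_id _ hy) (inj_eq (addIr _)); case: eqP => // _; apply: tpure0r.
- by rewrite tprojD hs ht; case: eqP => // _; rewrite addr0.
Qed.

Lemma tgcomp_indep (s : seq int) (y : int -> T) : uniq s ->
  (forall i, y i \in tgcomp i) -> \sum_(i <- s) y i = 0 ->
  forall i, i \in s -> y i = 0.
Proof.
move=> us hy s0 i si; move/(congr1 (tproj i)): s0.
rewrite tproj0 (big_morph (tproj i) (tprojD i) (tproj0 i)).
rewrite (bigD1_seq i) //= (tproj_id _ (hy i)) eqxx big1 ?addr0 // => j /negPf ji.
by rewrite (tproj_id _ (hy j)) eq_sym ji.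
Qed.

HB.instance Definition _ := isGraded.Build S^c T
  tgcomp_submod tgcomp_span tgcomp_indep.

Lemma gcomp_tpure i j (x : M) (y : B) :
  x \in gcomp i -> y \in gcomp j -> (tpure x y : T) \in gcomp (i + j).
Proof. exact: tgcomp_pure. Qed.

Lemma gcomp_tensor_ind n (P : T -> Prop) : P 0 ->
  (forall i (x : M) (y : B), x \in gcomp i -> y \in gcomp (n - i) -> P (tpure x y)) ->
  (forall s t, P s -> P t -> P (s + t)) -> forall t : T, t \in gcomp n -> P t.
Proof. exact: tgcomp_ind. Qed.
End TensorGrading.

Section TensorGradedBimodule.
Variables (A B : gbimodType S).

Lemma tlact_gcomp (a : S) i (t : tensor A B) : t \in gcomp i -> lact a t \in gcomp i.
Proof.
move: t; apply: gcomp_tensor_ind => [|j x y hx hy|s t hs ht].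
- suff -> : lact a (0 : tensor A B) = 0 by apply: gcomp0.
  by apply: (addrI (lact a (0 : tensor A B))); rewrite -lactDr !addr0.
- rewrite lact_tpure; have -> : i = j + (i - j) by rewrite addrC addrNK.
  by apply: gcomp_tpure => //; apply: lact_gcomp.
- by rewrite lactDr; apply: gcompD.
Qed.
HB.instance Definition _ := isGradedBimodule.Build k S (tensor A B) tlact_gcomp.
End TensorGradedBimodule.

(* S as a graded bimodule over itself, concentrated in degree 0. *)
Definition regbim : Type := (S^c)^o.
HB.instance Definition _ := GRing.Lmodule.copy regbim (S^c)^o.

Lemma regbim_lact_central (c : k) (x : regbim) :
  (c%:A * (x : S) : S) = ract x c%:A.
Proof. by rewrite mulr_algl -[RHS]/((x : S) * c%:A) mulr_algr. Qed.

HB.instance Definition _ := @isBimodule.Build k S regbim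
  (fun (a : S) (x : regbim) => (a * (x : S) : S))
  (fun a b x => mulrA a b (x : S)) (fun x => mul1r (x : S))
  (fun a b x => mulrDl a b (x : S)) (fun a x y => mulrDr a (x : S) (y : S))
  (fun a b x => mulrA a (x : S) b) regbim_lact_central.

Definition reg_gcomp (i : int) : {pred regbim} := fun x => (i == 0) || (x == 0).

Lemma reg_gcomp_submod i : GRing.submod_closed (reg_gcomp i).
Proof.
rewrite /reg_gcomp /in_mem /=; split=> [|a x y]; first by rewrite /in_mem /= eqxx orbT.
rewrite /in_mem /=; case: (i == 0) => //= /eqP -> /eqP ->.
by rewrite scaler0 addr0.
Qed.

Lemma reg_gcomp_span (x : regbim) : exists s : seq (int * regbim),
  (forall p, p \in s -> p.2 \in reg_gcomp p.1) /\ x = \sum_(p <- s) p.2.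
Proof. by exists [:: (0, x)]; rewrite big_seq1; split=> // p; rewrite inE => /eqP ->. Qed.

Lemma reg_gcomp_indep (s : seq int) (y : int -> regbim) : uniq s ->
  (forall i, y i \in reg_gcomp i) -> \sum_(i <- s) y i = 0 ->
  forall i, i \in s -> y i = 0.
Proof.
move=> us hy s0 i si.
have y0 j : j != 0 -> y j = 0.
  by move=> /negPf j0; have := hy j; rewrite /reg_gcomp /in_mem /= j0 => /eqP.
case: (eqVneq i 0) => [i0|/y0 //]; subst i.
move: s0; rewrite (bigD1_seq 0) //= big1 ?addr0 // => j; exact: y0.
Qed.

HB.instance Definition _ := isGraded.Build S^c regbim
  reg_gcomp_submod reg_gcomp_span reg_gcomp_indep.

Lemma gcomp_regbim i (x : regbim) : (x \in gcomp i) = (i == 0) || (x == 0).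
Proof. by []. Qed.

Lemma reg_lact_gcomp (a : S) i (x : regbim) : x \in gcomp i -> lact a x \in gcomp i.
Proof.
rewrite !gcomp_regbim; case: (i == 0) => //= /eqP ->.
by apply/eqP; exact: (mulr0 (a : S)).
Qed.
HB.instance Definition _ := isGradedBimodule.Build k S regbim reg_lact_gcomp.

Record bihom (d : int) (A B : gbimodType S) := Bihom {
  bihom_fun :> {linear A -> B};
  bihom_lact : forall a x, bihom_fun (lact a x) = lact a (bihom_fun x);
  bihom_deg : homogeneous d bihom_fun }.

Lemma bihom_id_subproof (A : gbimodType S) : homogeneous 0 (@idfun A).
Proof. by move=> j x; rewrite addr0. Qed.
Definition bihom_id (A : gbimodType S) : bihom 0 A A :=
  @Bihom 0 A A [the {linear A -> A} of idfun] (fun _ _ => erefl) (@bihom_id_subproof A).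

Section TensorMaps.
Variables (M N : gmodType S^c) (A B : gbimodType S).

Definition gsign (d : int) (x : M) : M :=
  gsum (fun i (y : M) => y *~ ((-1) ^+ `|d * i|)) x.

Lemma gsign_homog d i x : x \in gcomp i -> gsign d x = x *~ ((-1) ^+ `|d * i|).
Proof. by move=> hx; rewrite /gsign (gsum_homog _ hx) // => j; rewrite mul0rz. Qed.

Lemma gsignD d x y : gsign d (x + y) = gsign d x + gsign d y.
Proof. by apply: gsumD => *; apply: mulrzDl. Qed.

Lemma gsignZ d a x : gsign d (a *: x) = a *: gsign d x.
Proof.
have g0 : gsign d 0 = 0 by apply: (addrI (gsign d 0)); rewrite -gsignD !addr0.
have gs (z : int -> M) s : gsign d (\sum_(i <- s) z i) = \sum_(i <- s) gsign d (z i).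
  exact: (big_morph (gsign d) (gsignD d) g0).
rewrite [x]gproj_sum scaler_sumr !gs scaler_sumr; apply: eq_bigr => i _.
have hi := gproj_gcomp i x.
by rewrite (gsign_homog d hi) (gsign_homog d (gcompZ a hi)) scalerMzr.
Qed.

Lemma gsign0 x : gsign 0 x = x.
Proof.
rewrite [RHS]gproj_sum /gsign /gsum; apply: eq_bigr => i _.
by rewrite mul0r.
Qed.

(* f \otimes g with the Koszul sign (-1)^(|g||x|), d being the degree of g. *)
Definition tmap (d : int) (f : {linear M -> N}) (g : bihom d A B) :
    tensor M A -> tensor N B :=
  tlift (fun x y => tpure (f (gsign d x)) (g y)).

Section Theory.
Variables (d : int) (f : {linear M -> N}) (g : bihom d A B).

Let tmap_bal : tbalanced (fun (x : M) (y : A) => tpure (f (gsign d x)) (g y)).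
Proof.
split=> [x x' y|x y y'|x a y].
- by rewrite gsignD linearD tpureDl.
- by rewrite linearD tpureDr.
- by rewrite /ract gsignZ linearZ /= bihom_lact -tpure_bal.
Qed.

Lemma tmap_pure x y : tmap f g (tpure x y) = tpure (f (gsign d x)) (g y).
Proof. exact: (tlift_pure _ _ tmap_bal). Qed.

Lemma tmapD s t : tmap f g (s + t) = tmap f g s + tmap f g t.
Proof. exact: (tliftD _ _ tmap_bal). Qed.

Lemma tmap_linear : linear (tmap f g).
Proof.
move=> a s t; rewrite tmapD; congr (_ + _).
elim/tensor_ind: s => [x y|s1 s2 h1 h2]; last by rewrite scalerDr !tmapD h1 h2 scalerDr.
by rewrite tpureZ !tmap_pure linearZ /= tpureZ.
Qed.
HB.instance Definition _ := GRing.isLinear.Build S^c (tensor M A) (tensor N B) _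
  (tmap f g) tmap_linear.

Lemma tmap_homog i x y : x \in gcomp i ->
  tmap f g (tpure x y) = tpure (f x) (g y) *~ ((-1) ^+ `|d * i|).
Proof.
move=> hx; rewrite tmap_pure (gsign_homog d hx) raddfMz.
have td0 z : (fun x : N => tpure x z) 0 = 0 :> tensor N B by apply: tpure0l.
case: ((-1) ^+ _) => n.
  by rewrite -!pmulrn; elim: n => [|n ih]; rewrite ?mulr0n ?tpure0l // !mulrS tpureDl ih.
rewrite NegzE !mulrNz [LHS]pureNl; congr (- _).
by rewrite -!pmulrn; elim: n.+1 => [|m ih]; rewrite ?mulr0n ?pure0l // !mulrS pureDl ih.
Qed.

Lemma tmap_deg e : homogeneous e f -> homogeneous (e + d) (tmap f g).
Proof.
move=> hf n; apply: gcomp_tensor_ind => [|i x y hx hy|s t hs ht].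
- by rewrite raddf0; apply: gcomp0.
- rewrite (tmap_homog _ hx) -[_ *~ _]scaler_int; apply: gcompZ.
  have -> : n + (e + d) = (i + e) + ((n - i) + d).
    by rewrite addrACA [i + _]addrC addrNK.
  by apply: gcomp_tpure; [apply: hf|apply: bihom_deg].
- by rewrite tmapD; apply: gcompD.
Qed.
End Theory.
End TensorMaps.

Lemma tmap_lact (A A' B B' : gbimodType S) d e (f : bihom e A A') (g : bihom d B B') a t :
  tmap f g (lact a t) = lact a (tmap f g t).
Proof.
elim/tensor_ind: t => [x y|s t hs ht]; last by rewrite lactDr !tmapD hs ht lactDr.
rewrite lact_tpure !tmap_pure lact_tpure -bihom_lact; congr (tpure (f _) _).
have g0 : gsign d (0 : A) = 0.
  by apply: (addrI (gsign d (0 : A))); rewrite -gsignD !addr0.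
have l0 : lact a (0 : A) = 0 by apply: (addrI (lact a (0 : A))); rewrite -lactDr !addr0.
have gs (z : int -> A) s : gsign d (\sum_(i <- s) z i) = \sum_(i <- s) gsign d (z i).
  exact: (big_morph (gsign d) (gsignD d) g0).
have ls (z : int -> A) s : lact a (\sum_(i <- s) z i) = \sum_(i <- s) lact a (z i).
  exact: (big_morph (lact a) (lactDr a) l0).
have lN (z : A) : lact a (- z) = - lact a z.
  by apply: (addrI (lact a z)); rewrite -lactDr !subrr.
rewrite [x]gproj_sum ls !gs ls; apply: eq_bigr => i _.
have hi := gproj_gcomp i x.
rewrite (gsign_homog d hi) (gsign_homog d (lact_gcomp a _ _ hi)).
have ln n (z : A) : lact a (z *+ n) = lact a z *+ n.
  by elim: n => [|n ih]; rewrite ?mulr0n // !mulrS lactDr ih.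
case: ((-1) ^+ _) => n; first by rewrite -!pmulrn ln.
by rewrite NegzE !mulrNz lN -!pmulrn ln.
Qed.

Section Associativity.
Variables (M : gmodType S^c) (A B : gbimodType S).
Local Notation T1 := (tensor M (tensor A B)).
Local Notation T2 := (tensor (tensor M A) B).

Let arow (x : M) : tensor A B -> T2 := tlift (fun y z => tpure (tpure x y) z).

Let arow_bal x : tbalanced (fun (y : A) (z : B) => tpure (tpure x y) z : T2).
Proof.
split=> [y y' z|y z z'|y a z].
- by rewrite tpureDr tpureDl.
- exact: tpureDr.
- by rewrite /ract -tpureZ [LHS]tpure_bal.
Qed.

Let arow_pure x y z : arow x (tpure y z) = tpure (tpure x y) z.
Proof. exact: (tlift_pure _ _ (arow_bal x)). Qed.
Let arowD x s t : arow x (s + t) = arow x s + arow x t.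
Proof. exact: (tliftD _ _ (arow_bal x)). Qed.

(* The canonical isomorphism M (x) (A (x) B) -> (M (x) A) (x) B. *)
Definition tassoc : T1 -> T2 := tlift arow.

Let tassoc_bal : tbalanced arow.
Proof.
split=> [x x' t|x s t|x a t]; last 1 first.
- elim/tensor_ind: t => [y z|s t hs ht]; last by rewrite lactDr !arowD hs ht.
  by rewrite lact_tpure !arow_pure tpure_bal.
- elim/tensor_ind: t => [y z|s t hs ht]; last by rewrite !arowD hs ht addrACA.
  by rewrite !arow_pure !tpureDl.
- exact: arowD.
Qed.

Lemma tassocD s t : tassoc (s + t) = tassoc s + tassoc t.
Proof. exact: (tliftD _ _ tassoc_bal). Qed.

Lemma tassoc_pure x y z : tassoc (tpure x (tpure y z)) = tpure (tpure x y) z.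
Proof. by rewrite [LHS](tlift_pure _ _ tassoc_bal) arow_pure. Qed.

Lemma tassoc_linear : linear tassoc.
Proof.
move=> a s t; rewrite tassocD; congr (_ + _).
elim/tensor_ind: s => [x u|s1 s2 h1 h2]; last by rewrite scalerDr !tassocD h1 h2 scalerDr.
elim/tensor_ind: u => [y z|u v hu hv].
  by rewrite !tpureZ !tassoc_pure tpureZ.
by rewrite tpureDr scalerDr !tassocD hu hv scalerDr.
Qed.
HB.instance Definition _ := GRing.isLinear.Build S^c T1 T2 _ tassoc tassoc_linear.

Lemma tassoc_deg : homogeneous 0 tassoc.
Proof.
move=> n; rewrite addr0; apply: gcomp_tensor_ind => [|i x u hx|s t hs ht].
- by rewrite raddf0; apply: gcomp0.
- have [m em] : exists m, m = n - i by exists (n - i).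
  have en : n = i + m by rewrite em addrC addrNK.
  rewrite -em en; move: u; apply: gcomp_tensor_ind => [|j y z hy hz|s t hs ht].
  + by rewrite tpure0r raddf0; apply: gcomp0.
  + rewrite tassoc_pure; have -> : i + m = (i + j) + (m - j).
      by rewrite addrACA subrr addr0.
    by apply: gcomp_tpure => //; apply: gcomp_tpure.
  + by rewrite tpureDr tassocD; apply: gcompD.
- by rewrite tassocD; apply: gcompD.
Qed.
End Associativity.

Section Units.
Variable B : gbimodType S.

(* The canonical isomorphisms S (x) B -> B and B (x) S -> B. *)
Definition tlunit : tensor regbim B -> B := tlift (fun (a : regbim) y => lact (a : S) y).
Definition trunit : tensor B regbim -> B := tlift (fun y (a : regbim) => ract y (a : S)).

Let tlunit_bal : tbalanced (fun (a : regbim) (y : B) => lact (a : S) y).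
Proof.
split=> [a b y|a x y|a b y]; [exact: lactDl|exact: lactDr|].
by rewrite lactA.
Qed.
Let trunit_bal : tbalanced (fun (y : B) (a : regbim) => ract y (a : S)).
Proof.
split=> [x y a|y a b|y b a]; [exact: ractDr|exact: ractDl|].
by rewrite ractA.
Qed.
Lemma tlunit_pure a y : tlunit (tpure a y) = lact (a : S) y.
Proof. exact: (tlift_pure _ _ tlunit_bal). Qed.
Lemma tlunitD s t : tlunit (s + t) = tlunit s + tlunit t.
Proof. exact: (tliftD _ _ tlunit_bal). Qed.
Lemma trunit_pure y a : trunit (tpure y a) = ract y (a : S).
Proof. exact: (tlift_pure _ _ trunit_bal). Qed.
Lemma trunitD s t : trunit (s + t) = trunit s + trunit t.
Proof. exact: (tliftD _ _ trunit_bal). Qed.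
End Units.

Record dg_bocs := DGBocs {
  bcar :> gbimodType S;
  bmu : bihom 0 bcar (tensor bcar bcar);
  beps : bihom 0 bcar regbim;
  bdelta : bihom 1 bcar bcar;
  bmu_coassoc : forall x : bcar,
    tmap bmu (bihom_id bcar) (bmu x) = tassoc (tmap idfun bmu (bmu x));
  bmu_counitl : forall x : bcar,
    tlunit (tmap beps (bihom_id bcar) (bmu x)) = x;
  bmu_counitr : forall x : bcar, trunit (tmap idfun beps (bmu x)) = x;
  bmu_delta : forall x : bcar,
    bmu (bdelta x) = tmap idfun bdelta (bmu x) + tmap bdelta (bihom_id bcar) (bmu x);
  bdelta2 : forall x : bcar, bdelta (bdelta x) = 0 }.

(* The decomposition C = S (+) Cbar is recorded by the injections of S and
   Cbar into C and the projections of C onto them, the one onto S being the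
   counit. *)
Record normal_bocs := NormalBocs {
  nbocs :> dg_bocs;
  cbar : gbimodType S;
  nunit : bihom 0 regbim nbocs;
  nincl : bihom 0 cbar nbocs;
  nproj : bihom 0 nbocs cbar;
  eps_unit : forall a, beps nbocs (nunit a) = a;
  eps_incl : forall x, beps nbocs (nincl x) = 0;
  proj_unit : forall a, nproj (nunit a) = 0;
  proj_incl : forall x, nproj (nincl x) = x;
  unit_incl : forall x : nbocs, nunit (beps nbocs x) + nincl (nproj x) = x;
  mu_unit1 : bmu nbocs (nunit (1 : S)) = tpure (nunit (1 : S)) (nunit (1 : S)) }.

Section NormalBocs.
Variable B : normal_bocs.

Definition mubar_fun : {linear cbar B -> tensor (cbar B) (cbar B)} :=
  [the {linear _ -> _} of tmap (nproj B) (nproj B) \o (bmu B \o nincl B)].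

Lemma mubar_lact a x : mubar_fun (lact a x) = lact a (mubar_fun x).
Proof. by rewrite /= !bihom_lact tmap_lact. Qed.

Lemma mubar_deg : homogeneous 0 mubar_fun.
Proof.
move=> j x hx /=; have -> : j + 0 = ((j + 0) + 0) + (0 + 0) by rewrite !addr0.
by apply: tmap_deg (bihom_deg _) _ _ _; do 2!apply: bihom_deg.
Qed.

Definition mubar : bihom 0 (cbar B) (tensor (cbar B) (cbar B)) :=
  Bihom mubar_lact mubar_deg.

Definition deltabar_fun : {linear cbar B -> cbar B} :=
  [the {linear _ -> _} of nproj B \o (bdelta B \o nincl B)].

Lemma deltabar_lact a x : deltabar_fun (lact a x) = lact a (deltabar_fun x).
Proof. by rewrite /= !bihom_lact. Qed.

Lemma deltabar_deg : homogeneous 1 deltabar_fun.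
Proof.
move=> j x hx /=; have -> : j + 1 = ((j + 0) + 1) + 0 by rewrite !addr0.
by do 3!apply: bihom_deg.
Qed.

Definition deltabar : bihom 1 (cbar B) (cbar B) := Bihom deltabar_lact deltabar_deg.

Lemma mubarE x : let u := nunit B (1 : S) in
  tmap (nincl B) (nincl B) (mubar x) =
  bmu B (nincl B x) - tpure u (nincl B x) - tpure (nincl B x) u.
Proof.
move=> u.
have uE a : nunit B a = lact (a : S) u.
  by rewrite -bihom_lact; congr (nunit B _); rewrite -[LHS](mulr1 (a : S)).
have uE' a : nunit B a = ract u (a : S).
  rewrite /ract -linearZ; congr (nunit B _); rewrite -[LHS](mul1r (a : S)) //.
pose E (t : tensor B B) : tensor B B :=
  tpure u (tlunit (tmap (beps B) (bihom_id B) t)).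
pose E' (t : tensor B B) : tensor B B := tpure (trunit (tmap idfun (beps B) t)) u.
pose E2 (t : tensor B B) : tensor B B :=
  tpure u (nunit B (beps B (tlunit (tmap (beps B) (bihom_id B) t)))).
have ED s t : E (s + t) = E s + E t by rewrite /E tmapD tlunitD tpureDr.
have ED' s t : E' (s + t) = E' s + E' t by rewrite /E' tmapD trunitD tpureDl.
have ED2 s t : E2 (s + t) = E2 s + E2 t.
  by rewrite /E2 tmapD tlunitD !linearD tpureDr.
have key t : tmap (nincl B) (nincl B) (tmap (nproj B) (nproj B) t) =
    t - E t - E' t + E2 t.
  elim/tensor_ind: t => [x1 x2|s t hs ht]; last first.
    rewrite !tmapD hs ht ED ED' ED2 !opprD.
    rewrite [in RHS](addrACA s t) [in RHS](addrACA (s + _) (t + _)).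
    by rewrite [in RHS](addrACA (s + _ + _) (t + _ + _)).
  have pE y : nincl B (nproj B y) = y - nunit B (beps B y).
    by rewrite -{2}(unit_incl y) addrC addrA addNr add0r.
  have -> : E (tpure x1 x2) = tpure (nunit B (beps B x1)) x2.
    by rewrite /E tmap_pure gsign0 tlunit_pure uE' tpure_bal.
  have -> : E' (tpure x1 x2) = tpure x1 (nunit B (beps B x2)).
    by rewrite /E' tmap_pure gsign0 trunit_pure uE -tpure_bal.
  have -> : E2 (tpure x1 x2) = tpure (nunit B (beps B x1)) (nunit B (beps B x2)).
    by rewrite /E2 tmap_pure gsign0 tlunit_pure !bihom_lact -tpure_bal -uE'.
  rewrite !tmap_pure !gsign0 !pE tpureDl !tpureDr.
  have nl (y z : B) : tpure (- y) z = - tpure y z :> tensor B B.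
    by apply: (addrI (tpure y z)); rewrite -tpureDl !subrr tpure0l.
  have nr (y z : B) : tpure y (- z) = - tpure y z :> tensor B B.
    by apply: (addrI (tpure y z)); rewrite -tpureDr !subrr tpure0r.
  rewrite !nl !nr opprK addrA; congr (_ + _).
  by rewrite -!addrA; congr (_ + _); rewrite addrC.
rewrite [mubar x]/= key /E /E' /E2 bmu_counitl bmu_counitr eps_incl.
by rewrite linear0 tpure0r addr0.
Qed.

Lemma eps_sign x : beps B (gsign 1 x) = beps B x.
Proof.
rewrite [x in RHS]gproj_sum /gsign /gsum !linear_sum; apply: eq_bigr => i _ /=.
have := bihom_deg (beps B) (gproj_gcomp i x).
rewrite gcomp_regbim addr0 raddfMz /= => /orP[/eqP ->|/eqP ->]; last exact: mul0rz.
by rewrite mulr0.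
Qed.

Lemma eps_delta x : beps B (bdelta B x) = 0.
Proof.
pose Phi (t : tensor B B) := beps B (tlunit (tmap (beps B) (bihom_id B) t)).
have PhiD s t : Phi (s + t) = Phi s + Phi t by rewrite /Phi tmapD tlunitD linearD.
have h1 t : Phi (tmap idfun (bdelta B) t) =
    beps B (bdelta B (tlunit (tmap (beps B) (bihom_id B) t))).
  elim/tensor_ind: t => [x1 x2|s t hs ht].
    rewrite /Phi !tmap_pure gsign0 !tlunit_pure /= eps_sign gsign0.
    by rewrite -!bihom_lact.
  by rewrite !tmapD PhiD hs ht tlunitD !linearD.
have h2 t : Phi (tmap (bdelta B) (bihom_id B) t) =
    beps B (bdelta B (trunit (tmap idfun (beps B) t))).
  elim/tensor_ind: t => [x1 x2|s t hs ht].
    rewrite /Phi !tmap_pure !gsign0 tlunit_pure trunit_pure /= bihom_lact.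
    by rewrite /ract !linearZ.
  by rewrite !tmapD PhiD hs ht trunitD !linearD.
have := erefl (Phi (bmu B (bdelta B x))).
rewrite {2}bmu_delta PhiD h1 h2 bmu_counitl bmu_counitr /Phi bmu_counitl.
by rewrite -{1}[beps B _]addr0 => /addrI.
Qed.

Lemma deltabarE x : nincl B (deltabar x) = bdelta B (nincl B x).
Proof. by rewrite -[RHS]unit_incl eps_delta linear0 add0r. Qed.

Lemma incl_inj : injective (nincl B).
Proof. exact: can_inj (proj_incl (n := B)). Qed.

End NormalBocs.

Definition graded_subbimodule (C : gbimodType S) (U : {pred C}) : Prop :=
  [/\ GRing.submod_closed U,
      forall a x, x \in U -> lact a x \in U &
      forall i x, x \in U -> gproj i x \in U].

(* U (x) U as a subset of C (x) C *)
Definition in_tensor_square (C : gbimodType S) (U : {pred C}) (t : tensor C C) : Prop :=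
  exists s : seq (C * C),
    (forall p, p \in s -> p.1 \in U /\ p.2 \in U) /\ t = \sum_(p <- s) tpure p.1 p.2.

Definition triangular (B : normal_bocs) : Prop :=
  exists F : nat -> {pred cbar B},
  [/\ forall i, graded_subbimodule (F i),
      forall x, (x \in F 0) = (x == 0),
      forall i, {subset F i <= F i.+1},
      forall x, exists i, x \in F i &
      forall i x, x \in F i.+1 ->
        in_tensor_square (F i) (mubar B x) /\ deltabar B x \in F i.+1].

Section Category.
Variable B : normal_bocs.
Local Notation C := (cbar B).

Record bocs_hom (M N : gmodType S^c) := BocsHom {
  bh0 : ghom M N;
  bh1 : ghom (tensor M C) N }.

Section Composition.
Variables (L M N : gmodType S^c) (g : bocs_hom M N) (f : bocs_hom L M).

Definition comp0_fun : {linear L -> N} := [the {linear _ -> _} of bh0 g \o bh0 f].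

Lemma comp0_deg : homogeneous 0 comp0_fun.
Proof. by move=> j x hx; rewrite -[_ + 0]addr0 /=; do 2!apply: ghom_deg. Qed.

(* id_L (x) mubar, followed by the identification of L (x) (C (x) C) with
   (L (x) C) (x) C *)
Definition tmubar : {linear tensor L C -> tensor (tensor L C) C} :=
  [the {linear _ -> _} of @tassoc L C C \o tmap idfun (mubar B)].

Definition comp1_fun : {linear tensor L C -> N} :=
  [the {linear _ -> _} of
    (bh1 g \o tmap (bh0 f) (bihom_id C)) \+ (bh0 g \o bh1 f) \+
    (bh1 g \o (tmap (bh1 f) (bihom_id C) \o tmubar))].

Lemma comp1_deg : homogeneous 0 comp1_fun.
Proof.
have d0 (X Y : gmodType S^c) (h : {linear X -> Y}) (A A' : gbimodType S)
    (u : bihom 0 A A') : homogeneous 0 h -> homogeneous 0 (tmap h u).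
  by move=> hh; have := tmap_deg u hh; rewrite addr0.
have d1 (X Y : gmodType S^c) (h : X -> Y) j x :
    homogeneous 0 h -> x \in gcomp j -> h x \in gcomp j.
  by move=> hh /hh; rewrite addr0.
move=> j x hx /=; rewrite addr0.
apply: gcompD; first apply: gcompD.
- by apply: (d1 _ _ _ _ _ (ghom_deg _)); apply: (d1 _ _ _ _ _ (d0 _ _ _ _ _ _ (ghom_deg _))).
- by apply: (d1 _ _ _ _ _ (ghom_deg _)); apply: (d1 _ _ _ _ _ (ghom_deg _)).
- apply: (d1 _ _ _ _ _ (ghom_deg _)); apply: (d1 _ _ _ _ _ (d0 _ _ _ _ _ _ (ghom_deg _))).
  apply: (d1 _ _ _ _ _ (@tassoc_deg _ _ _)); apply: (d1 _ _ _ _ _ (d0 _ _ _ _ _ _ _)) => //.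
  by move=> i y; rewrite addr0.
Qed.

Definition bocs_comp : bocs_hom L N := BocsHom (GHom comp0_deg) (GHom comp1_deg).
End Composition.

Lemma zero_deg (M N : gmodType S^c) :
  homogeneous 0 ([the {linear M -> N} of \0] : {linear M -> N}).
Proof. by move=> j x _; apply: gcomp0. Qed.

Lemma id_deg (M : gmodType S^c) :
  homogeneous 0 ([the {linear M -> M} of idfun] : {linear M -> M}).
Proof. by move=> j x; rewrite addr0. Qed.

Definition bocs_id (M : gmodType S^c) : bocs_hom M M :=
  BocsHom (GHom (@id_deg M)) (GHom (@zero_deg (tensor M C) M)).

Lemma ghom_ext (M N : gmodType S^c) (f g : ghom M N) : f =1 g -> f = g.
Proof.
case: f g => f hf [g hg] /= fg.
have {fg} e : f = g.
  case: f hf fg => f cf hf; case: g hg => g cg hg /= fg.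
  have e : f = g by apply: funext.
  case: _ / e cg {hg fg} => cg; congr GRing.Linear.Pack.
  case: cf {hf} => [[a1] [b1]]; case: cg => [[a2] [b2]].
  by rewrite (Prop_irrelevance a1 a2) (Prop_irrelevance b1 b2).
by case: _ / e hg => hg; rewrite (Prop_irrelevance hf hg).
Qed.

Lemma bocs_hom_ext (M N : gmodType S^c) (f g : bocs_hom M N) :
  bh0 f =1 bh0 g -> bh1 f =1 bh1 g -> f = g.
Proof. by case: f g => f0 f1 [g0 g1] /= /ghom_ext -> /ghom_ext ->. Qed.

Definition bocs_iso (M N : gmodType S^c) (f : bocs_hom M N) : Prop :=
  exists g : bocs_hom N M, bocs_comp g f = bocs_id M /\ bocs_comp f g = bocs_id N.
End Category.

End Bocses.

(* Main.v *)
(* If [f^0] is invertible with inverse [h], the equation [(g * f)^1 = 0] with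
   [g^0 = h] reads [g^1 = a + g^1 T], where [a = - h f^1 (h (x) id)] and
   [T = - (f^1 (x) id) (id (x) mubar) (h (x) id)].  Triangularity makes [T]
   locally nilpotent, because [T] maps the image of [N (x) F_(i+1)] into that of
   [N (x) F_i], so [g^1 = sum_j a T^j] is a solution and [f] has a left inverse
   [g].  Since [g^0 = h] is invertible, [g] has a left inverse too, and by
   associativity of the composition it must be [f]. *)
Require Import Defs.
From HB Require Import structures.
From mathcomp Require Import all_boot all_order all_algebra all_field.
From mathcomp Require Import boolp.
Import GRing.Theory.
Local Open Scope ring_scope.

Set Implicit Arguments.
Unset Strict Implicit.

(** * Neumann series of a locally nilpotent graded endomorphism *)

Section LocallyNilpotent.
Variables (R : pzRingType) (X Y : gmodType R) (T : ghom X X) (a : ghom X Y).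
Hypothesis Tnil : forall t, exists n, iter n T t = 0.

Lemma iter0 n : iter n T 0 = 0.
Proof. by elim: n => //= n ->; rewrite linear0. Qed.

Lemma iter_eq0_leq m n t : (m <= n)%N -> iter m T t = 0 -> iter n T t = 0.
Proof. by move=> mn t0; rewrite -(subnK mn) iterD t0 iter0. Qed.

(** An arbitrary exponent killing [t], chosen for each [t] separately and without any relation to
    sums or scalar multiples. *)
Let ord t := projT1 (cid (Tnil t)).

Definition neumann t : Y := \sum_(j < ord t) a (iter j T t).

(** All terms past a vanishing iterate are zero, so the choice in [ord] is immaterial and several
    vectors can share one truncation bound. *)
Lemma neumannE m t : iter m T t = 0 -> neumann t = \sum_(j < m) a (iter j T t).
Proof.
have aux p q : (p <= q)%N -> iter p T t = 0 ->
    \sum_(j < q) a (iter j T t) = \sum_(j < p) a (iter j T t).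
  move=> pq p0; rewrite -!(big_mkord xpredT (fun j => a (iter j T t))).
  rewrite (big_cat_nat (leq0n p) pq) /= [X in _ + X]big_nat [X in _ + X]big1.
    by rewrite addr0.
  move=> j /andP[pj _].
  by rewrite (iter_eq0_leq pj p0) linear0.
have o0 : iter (ord t) T t = 0 by rewrite /ord; case: cid.
by move=> m0; rewrite /neumann; case: (leqP m (ord t)) => [/aux|/ltnW/aux] ->.
Qed.

Lemma neumann_linear : linear neumann.
Proof.
move=> c s t.
have iter_lin n : iter n T (c *: s + t) = c *: iter n T s + iter n T t.
  by elim: n => //= n ->; rewrite linearP.
have [[p sp] [q tq]] := (Tnil s, Tnil t); pose m := maxn p q.
have sm : iter m T s = 0 by apply: iter_eq0_leq sp; apply: leq_maxl.
have tm : iter m T t = 0 by apply: iter_eq0_leq tq; apply: leq_maxr.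
rewrite (neumannE sm) (neumannE tm) (@neumannE m) ?iter_lin ?sm ?tm ?scaler0 ?addr0 //.
rewrite scaler_sumr -big_split; apply: eq_bigr => j _ /=.
by rewrite iter_lin linearP.
Qed.
HB.instance Definition _ := GRing.isLinear.Build R X Y _ neumann neumann_linear.

Lemma neumann_deg : homogeneous 0 neumann.
Proof.
move=> d x hx; apply: gcomp_sum => j _ _; apply: ghom_deg.
elim: {j}(nat_of_ord j) => //= j ih.
by rewrite -[d]addr0; apply: ghom_deg.
Qed.

Lemma neumann_exists : exists g : ghom X Y, forall t, g t = a t + g (T t).
Proof.
exists (GHom neumann_deg) => t /=; have [n n0] := Tnil t.
(* Truncating at [n.+1] for [t] and at [n] for [T t] makes the two sums differ exactly by the term
   [j = 0], which is [a t]. *)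
have n1 : iter n.+1 T t = 0 by rewrite /= n0 linear0.
have n0' : iter n T (T t) = 0 by rewrite -iterSr.
rewrite (neumannE n1) (neumannE n0') big_ord_recl; congr (_ + _).
by apply: eq_bigr => j _; rewrite /= -iterS iterSr.
Qed.
End LocallyNilpotent.

(** * Tensor products of degree 0 maps, where the Koszul sign is trivial *)

Section Tensors.
Variables (k : fieldType) (S : falgType k).

Lemma tmap0_pure (M N : gmodType S^c) (A A' : gbimodType S)
    (f : {linear M -> N}) (g : bihom 0 A A') x y :
  tmap f g (tpure x y) = tpure (f x) (g y).
Proof. by rewrite tmap_pure gsign0. Qed.

Lemma tmap0_deg (M N : gmodType S^c) (A A' : gbimodType S)
    (f : {linear M -> N}) (g : bihom 0 A A') :
  homogeneous 0 f -> homogeneous 0 (tmap f g).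
Proof. by move=> hf; have := tmap_deg g hf; rewrite addr0. Qed.

(** Functoriality of the tensor product. The composites [h] and [e] are given only up to pointwise
    equality, so any bundled map with the right values can stand for them. *)
Lemma tmap0_comp (L M N : gmodType S^c) (A A' A'' : gbimodType S)
    (f : {linear M -> N}) (f' : {linear L -> M}) (h : {linear L -> N})
    (g : bihom 0 A' A'') (g' : bihom 0 A A') (e : bihom 0 A A'') :
  (forall x, f (f' x) = h x) -> (forall y, g (g' y) = e y) ->
  forall t, tmap f g (tmap f' g' t) = tmap h e t.
Proof.
move=> fh ge; elim/tensor_ind => [x y|s t hs ht]; last by rewrite !tmapD hs ht.
by rewrite !tmap0_pure fh ge.
Qed.

Section LeftPure.
Variables (M : gmodType S^c) (A : gbimodType S) (x : M).
(** As a bundled linear map, it can be fed to [tmap], which turns re-association of [x (x) t] into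
    functoriality. *)
Definition lpure (y : A) : tensor M A := tpure x y.
Lemma lpure_linear : linear lpure.
Proof. by move=> a y z; rewrite /lpure tpureDr tpureZ. Qed.
HB.instance Definition _ := GRing.isLinear.Build S^c A (tensor M A) _ lpure lpure_linear.
End LeftPure.

Lemma tassoc_lpure (M : gmodType S^c) (A A' : gbimodType S) (x : M) (t : tensor A A') :
  tassoc (tpure x t) = tmap (lpure x) (bihom_id A') t.
Proof.
elim/tensor_ind: t => [y z|s t hs ht]; last by rewrite tpureDr tassocD tmapD hs ht.
by rewrite tassoc_pure tmap0_pure.
Qed.

End Tensors.

(** * Coassociativity of the reduced comultiplication *)

Section Bocs.
Variables (k : fieldType) (S : falgType k) (B : normal_bocs S).
Local Notation C := (cbar B).
Local Notation idC := (bihom_id C).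

(** The unit part contributes nothing: [mu(a) = a (1 (x) 1)] for [a] in [S], and the projection
    kills [1]. This transports identities from [bmu] to [mubar]. *)
Lemma mubar_proj (x : B) : tmap (nproj B) (nproj B) (bmu B x) = mubar B (nproj B x).
Proof.
have mu_unit a : tmap (nproj B) (nproj B) (bmu B (nunit B a)) = 0.
  have -> : a = lact (a : S) ((1 : S) : regbim S) by rewrite -[LHS](mulr1 (a : S)).
  rewrite !bihom_lact mu_unit1 lact_tpure tmap0_pure -bihom_lact.
  by rewrite !proj_unit tpure0r.
by rewrite -{1}(unit_incl x) linearD tmapD mu_unit add0r.
Qed.

Lemma mubar_coassoc (x : C) :
  tmap (mubar B) idC (mubar B x) = tassoc (tmap idfun (mubar B) (mubar B x)).
Proof.
pose p := nproj B; pose pp : {linear tensor B B -> tensor C C} := tmap p p.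
pose mup : {linear B -> tensor C C} := pp \o bmu B.
have mupE y : mubar B (p y) = mup y by rewrite -mubar_proj.
have -> : mubar B x = tmap p p (bmu B (nincl B x)) by [].
(* The left side becomes [(pp (x) p) (mu (x) id) mu], ready for the coassociativity of [bmu]. *)
rewrite (@tmap0_comp _ _ _ _ _ _ _ _ _ _ mup _ _ p) //.
rewrite -(@tmap0_comp _ _ _ _ _ _ _ _ pp (bmu B) mup p (bihom_id B) p) //.
rewrite bmu_coassoc.
elim/tensor_ind: (bmu B _) => [y z|s t hs ht]; last first.
  by rewrite tmapD tassocD tmapD hs ht !(tmapD, tassocD).
rewrite !tmap0_pure [mubar B _]mupE -[mup z]/(tmap p p (bmu B z)) !tassoc_lpure.
pose l : {linear B -> tensor C C} := lpure (p y) \o p.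
by transitivity (tmap l p (bmu B z)); [|symmetry]; apply: tmap0_comp => // w;
  apply: tmap0_pure.
Qed.

Lemma tmubarE (M : gmodType S^c) (x : M) c :
  tmubar B M (tpure x c) = tmap (lpure x) idC (mubar B c).
Proof. by rewrite /= tmap0_pure tassoc_lpure. Qed.

Lemma tmubarD (M : gmodType S^c) s t :
  tmubar B M (s + t) = tmubar B M s + tmubar B M t.
Proof. exact: raddfD. Qed.

(** Together with [tmubar_coassoc], this makes [- (x) C] with [tmubar] a comonad without counit;
    [bocs_comp] is its co-Kleisli composition with identities adjoined formally. *)
Lemma tmubar_nat (M N : gmodType S^c) (f : {linear M -> N}) t :
  tmubar B N (tmap f idC t) = tmap (tmap f idC) idC (tmubar B M t).
Proof.
elim/tensor_ind: t => [x c|s t hs ht]; last first.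
  by rewrite tmapD !tmubarD hs ht !tmapD.
rewrite tmap0_pure !tmubarE.
rewrite (@tmap0_comp _ _ _ _ _ _ _ _ _ _ (lpure (f x)) _ _ idC) // => d.
exact: tmap0_pure.
Qed.

Lemma tmubar_coassoc (M : gmodType S^c) t :
  tmubar B (tensor M C) (tmubar B M t) = tmap (tmubar B M) idC (tmubar B M t).
Proof.
elim/tensor_ind: t => [x c|s t hs ht]; last by rewrite !tmubarD hs ht tmapD.
rewrite !tmubarE.
rewrite (@tmap0_comp _ _ _ _ _ _ _ _ (tmubar B M) (lpure x)
   (tmap (lpure x) idC \o mubar B : {linear C -> _}) _ _ idC) //; last first.
  by move=> d; exact: tmubarE.
rewrite -(@tmap0_comp _ _ _ _ _ _ _ _ (tmap (lpure x) idC) (mubar B) _ idC idC) //.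
rewrite mubar_coassoc.
elim/tensor_ind: (mubar B c) => [d e|s t hs ht]; last first.
  by rewrite tmapD tmubarD hs ht !(tmapD, tassocD).
rewrite !tmap0_pure tmubarE tassoc_lpure.
by rewrite (@tmap0_comp _ _ _ _ _ _ _ _ _ _ (lpure (lpure x d)) _ _ idC) // => e';
  rewrite /= tmap0_pure.
Qed.
End Bocs.

(** * Associativity and identities of the composition *)

Section Composition.
Variables (k : fieldType) (S : falgType k) (B : normal_bocs S).
Local Notation C := (cbar B).
Local Notation idC := (bihom_id C).

Lemma bocs_comp1E (L M N : gmodType S^c) (g : bocs_hom B M N) (f : bocs_hom B L M) t :
  bh1 (bocs_comp g f) t = bh1 g (tmap (bh0 f) idC t) + bh0 g (bh1 f t)
    + bh1 g (tmap (bh1 f) idC (tmubar B L t)).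
Proof. by []. Qed.

Lemma tmap_comp1E (L M N : gmodType S^c) (g : bocs_hom B M N) (f : bocs_hom B L M) t :
  tmap (bh1 (bocs_comp g f)) idC t =
    tmap (bh1 g) idC (tmap (tmap (bh0 f) idC) idC t) + tmap (bh0 g) idC (tmap (bh1 f) idC t)
    + tmap (bh1 g) idC (tmap (tmap (bh1 f) idC) idC (tmap (tmubar B L) idC t)).
Proof.
elim/tensor_ind: t => [x c|s t hs ht]; last first.
  by rewrite !tmapD hs ht addrACA; congr (_ + _); rewrite addrACA.
by rewrite !tmap0_pure bocs_comp1E !tpureDl.
Qed.

(** Both sides expand into seven terms, one for each nonempty subset of [{f, g, h}] entering through
    its component [bh1]. Naturality of [tmubar] serves those with [h^1] and [g^1]; coassociativity
    serves the one with all three. *)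
Lemma bocs_compA (K L M N : gmodType S^c) (h : bocs_hom B M N)
    (g : bocs_hom B L M) (f : bocs_hom B K L) :
  bocs_comp (bocs_comp h g) f = bocs_comp h (bocs_comp g f).
Proof.
apply: bocs_hom_ext => // t.
rewrite [LHS]bocs_comp1E [RHS]bocs_comp1E !(bocs_comp1E h g) (bocs_comp1E g f).
rewrite tmap_comp1E tmubar_nat tmubar_nat tmubar_coassoc.
rewrite (@tmap0_comp _ _ _ _ _ _ _ _ (bh0 g) (bh0 f) (bh0 (bocs_comp g f)) _ _ idC) //.
rewrite !(raddfD (bh0 h)) !(raddfD (bh1 h)) !addrA.
have perm (V : zmodType) (a b c d e u v : V) :
    a + b + c + d + e + u + v = a + b + d + u + c + e + v.
  congr (_ + _); rewrite -!addrA; congr (_ + (_ + _)).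
  by rewrite addrCA; congr (_ + _); rewrite addrA addrC.
exact: perm.
Qed.

Lemma bocs_comp1f (M N : gmodType S^c) (f : bocs_hom B M N) :
  bocs_comp (bocs_id B N) f = f.
Proof. by apply: bocs_hom_ext => // t; rewrite bocs_comp1E /= add0r addr0. Qed.

Lemma bocs_compf1 (M N : gmodType S^c) (f : bocs_hom B M N) :
  bocs_comp f (bocs_id B M) = f.
Proof.
apply: bocs_hom_ext => // t; rewrite bocs_comp1E.
have -> : tmap (bh0 (bocs_id B M)) idC t = t.
  by elim/tensor_ind: t => [x c|s t hs ht]; rewrite ?tmapD ?hs ?ht ?tmap0_pure.
have tmap0 u : tmap (bh1 (bocs_id B M)) idC u = 0.
  elim/tensor_ind: u => [x c|s u hs hu]; last by rewrite tmapD hs hu addr0.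
  by rewrite tmap0_pure tpure0l.
by rewrite tmap0 !linear0 !addr0.
Qed.

(** * Local nilpotence and left inverses from triangularity *)

Hypothesis triB : triangular B.

Lemma tmubar_nilpotent (M N : gmodType S^c) (u : {linear N -> M})
    (v : {linear tensor M C -> N}) (T : {linear tensor N C -> tensor N C}) :
  (forall t, T t = - tmap v idC (tmubar B M (tmap u idC t))) ->
  forall t, exists n, iter n T t = 0.
Proof.
move=> TE; case: triB => F [_ F0 _ Fex Fmu].
have iterD n s t : iter n T (s + t) = iter n T s + iter n T t.
  by elim: n => //= n ->; rewrite linearD.
have iter0 n : iter n T 0 = 0 by elim: n => //= n ->; rewrite linear0.
have pure_nil n x c : c \in F n -> iter n T (tpure x c) = 0.
  elim: n x c => [|n ih] x c; first by rewrite F0 => /eqP ->; apply: tpure0r.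
  case/Fmu => -[s [hs muE]] _; rewrite iterSr TE tmap0_pure tmubarE muE.
  elim: s hs {muE} => [|p s ihs] hs.
    by rewrite big_nil [tmap (lpure _) _ _]raddf0 [tmap v _ _]raddf0 oppr0 iter0.
  rewrite big_cons !tmapD opprD iterD ihs ?addr0; last first.
    by move=> q qs; apply: hs; rewrite inE qs orbT.
  (* The left leg [p.1] is absorbed into [N] by [v], the right leg [p.2] stays in [F n]; the sign
     moves to the left factor so that a pure tensor remains. *)
  rewrite !tmap0_pure -[- _]pureNl; apply: ih.
  by case: (hs p (mem_head _ _)).
elim/tensor_ind => [x c|s t [p sp] [q tq]].
  by have [n cn] := Fex c; exists n; apply: pure_nil.
exists (p + q)%N.
by rewrite iterD [in X in X + _]addnC !ssrnat.iterD sp tq !iter0 addr0.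
Qed.

(** Recording [bh0 g = h] allows a second application, to [g] itself. *)
Lemma left_inverse (M N : gmodType S^c) (f : bocs_hom B M N) (h : ghom N M) :
  cancel (bh0 f) h -> cancel h (bh0 f) ->
  exists g : bocs_hom B N M, bh0 g = h /\ bocs_comp g f = bocs_id B M.
Proof.
move=> fK hK.
have tfK (t : tensor M C) : tmap h idC (tmap (bh0 f) idC t) = t.
  by elim/tensor_ind: t => [x c|s t hs ht]; rewrite ?tmapD ?hs ?ht // !tmap0_pure fK.
pose T0 : {linear tensor N C -> tensor N C} :=
  \- (tmap (bh1 f) idC \o (tmubar B M \o tmap h idC)).
pose a0 : {linear tensor N C -> M} := \- (h \o (bh1 f \o tmap h idC)).
have deg0 (X Y : gmodType S^c) (F : X -> Y) j x :
    homogeneous 0 F -> x \in gcomp j -> F x \in gcomp j by move=> FP /FP; rewrite addr0.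
have tdeg : homogeneous 0 (tmap h idC) by apply/tmap0_deg/ghom_deg.
have T0deg : homogeneous 0 T0.
  move=> j x hx; rewrite addr0; apply: gcompN.
  apply: (deg0 _ _ _ _ _ (tmap0_deg _ (ghom_deg _))).
  apply: (deg0 _ _ _ _ _ (@tassoc_deg _ _ _ _ _)).
  apply: (deg0 _ _ _ _ _ (tmap0_deg _ _)) => [i y|]; first by rewrite addr0.
  exact: deg0.
have a0deg : homogeneous 0 a0.
  move=> j x hx; rewrite addr0; apply: gcompN.
  do 2!apply: (deg0 _ _ _ _ _ (ghom_deg _)).
  exact: deg0.
have Tnil : forall t, exists n, iter n (GHom T0deg) t = 0.
  exact: (@tmubar_nilpotent _ _ h (bh1 f) T0).
have [g1 g1E] := neumann_exists (GHom a0deg) Tnil.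
exists (BocsHom h g1); split=> //; apply: bocs_hom_ext => [x|t]; first exact: fK.
(* The equation for [g1] is used at [(f^0 (x) id) t], where [h (x) id] cancels; it yields the
   negatives of the other two terms. *)
rewrite bocs_comp1E /= g1E /= !tfK linearN /=.
by rewrite addrAC addrNK addNr.
Qed.

End Composition.

Theorem corollary4p8 (k : fieldType) (S : falgType k)
  (hS : semisimple_ring S) (hSe : semisimple_ring (envelope S))
  (B : normal_bocs S) (hB : triangular B)
  (M N : gmodType S^c) (f : bocs_hom B M N) :
  bocs_iso f <-> ghom_iso (bh0 f).
Proof.
split=> [[g [gf fg]]|[h [fK hK]]].
  exists (bh0 g); split=> x.
    exact: (congr1 (fun u => bh0 u x) gf).
  exact: (congr1 (fun u => bh0 u x) fg).
have [g [g0 gf]] := left_inverse hB fK hK.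
have [|| f' [_ f'g]] := @left_inverse _ _ _ hB _ _ g (bh0 f); rewrite ?g0 //.
exists g; split=> //; rewrite -[RHS]f'g; congr (bocs_comp _ g).
(* [f = (f' * g) * f = f' * (g * f) = f']. *)
by rewrite -[LHS]bocs_comp1f -f'g bocs_compA gf bocs_compf1.
Qed.
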